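(* Suppose the self-similar measure $\mu$ satisfies the standard technical assumptions. Then the set of non-essential points of $[0,1]$ is a subset of a closed set of Lebesgue measure $0$.
   Context: Measure. Let $m\ge 1$, $0<\varrho<1$, $d_0<\dots<d_m$ real, $S_j(x)=\varrho x+d_j$, $\mathcal A=\{0,\dots,m\}$. For $\sigma=(j_1,\dots,j_n)\in\mathcal A^n$ put $S_\sigma=S_{j_1}\circ\cdots\circ S_{j_n}$. Given $p_j>0$ with $\sum_j p_j=1$, $\mu$ is the unique Borel probability measure with $\mu=\sum_{j=0}^m p_j\,\mu\circ S_j^{-1}$. It is of finite type if there is a finite set $F\subset[0,\infty)$ such that for all $n\ge1$ and $\sigma,\sigma'\in\mathcal A^n$ either $\varrho^{-n}|S_\sigma(0)-S_{\sigma'}(0)|>c$ or $\varrho^{-n}|S_\sigma(0)-S_{\sigma'}(0)|\in F$, where $c=(1-\varrho)^{-1}(d_m-d_0)$. Standard technical assumptions: $\mu$ is such a measure and is of finite type; $p_0=p_m=\min_j p_j$; and $\operatorname{supp}\mu=[0,1]$ (equivalently $d_0=0$, $d_m=1-\varrho$, $d_{i+1}-d_i\le\varrho$ for all $i$). Net intervals and characteristic vectors. For $n\ge1$ let $h_1<\dots<h_{s_n}$ be the distinct elements of $\{S_\sigma(0),S_\sigma(1):\sigma\in\mathcal A^n\}$; the net intervals of level $n$ are $\mathcal F_n=\{[h_j,h_{j+1}]:1\le j<s_n\}$, and $\mathcal F_0=\{[0,1]\}$. Each $\Delta\in\mathcal F_n$ ($n\ge1$) lies in a unique $\widehat\Delta\in\mathcal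 F_{n-1}$, its parent ($\Delta$ is a child of $\widehat\Delta$). For $\Delta=[a,b]\in\mathcal F_n$ put $\ell_n(\Delta)=\varrho^{-n}(b-a)$, and let $V_n(\Delta)=(a_1,\dots,a_k)$ be the increasing list of the distinct values $\varrho^{-n}(a-S_\sigma(0))$ over $\sigma\in\mathcal A^n$ with $\Delta\subseteq S_\sigma[0,1]$. Let $r_n(\Delta)$ be the position of $\Delta$, from left to right, among the children of $\widehat\Delta$ with the same $\ell_n$ and $V_n$. The characteristic vector is $\mathcal C_n(\Delta)=(\ell_n(\Delta),V_n(\Delta),r_n(\Delta))$, with $\mathcal C_0([0,1])=(1,(0),1)$. $\Omega$ is the (finite) set of all characteristic vectors. $\beta\in\Omega$ is a child of $\alpha\in\Omega$ (its parent) if $\alpha=\mathcal C_{n-1}(\widehat\Delta)$, $\beta=\mathcal C_n(\Delta)$ for some parent/child pair. An admissible path is a tuple $(\gamma_1,\dots,\gamma_n)$ in $\Omega$ with each $\gamma_j$ the parent of $\gamma_{j+1}$. A symbolic representation of $x\in[0,1]$ is $[x]=(\mathcal C_0(\Delta_0),\mathcal C_1(\Delta_1),\dots)$, where $x\in\Delta_n\in\mathcal F_n$ and $\Delta_n$ is the parent of $\Delta_{n+1}$ for all $n$ (unique unless $x$ is an endpoint of a net interval, in which case there may be two). Loop and essential classes. A non-empty $\Omega'\subseteq\Omega$ is a loop class if for all $\alpha,\beta\in\Omega'$ there is an admissible path $(\gamma_1,\dots,\gamma_n)$, $n\ge2$, with all $\gamma_j\in\Omega'$, $\gamma_1=\alpha$,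 $\gamma_n=\beta$. The essential class $\Omega_0$ is the loop class with the further property that every child in $\Omega$ of an element of $\Omega_0$ is in $\Omega_0$; there is exactly one such class (a known result of Feng). A point $x$ is essential if it has a symbolic representation $(\gamma_0,\gamma_1,\dots)$ with $\gamma_j\in\Omega_0$ for all large $j$, and non-essential otherwise. *)

(* Defs.v *)
From mathcomp Require Import all_boot all_order all_algebra.
From mathcomp Require Import all_classical all_reals all_analysis.

Set Implicit Arguments.
Unset Strict Implicit.
Unset Printing Implicit Defensive.

Import Order.TTheory GRing.Theory Num.Theory.
Import numFieldNormedType.Exports.

Local Open Scope classical_set_scope.
Local Open Scope ring_scope.

Section IteratedFunctionSystem.
Context {R : realType} {m : nat} (rho : R) (d : 'I_m.+1 -> R).

Definition contraction (j : 'I_m.+1) (x : R) : R := rho * x + d j.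

(* [:: j_1; ...; j_n] acts as S_{j_1} \o ... \o S_{j_n}. *)
Definition word_map (s : seq 'I_m.+1) (x : R) : R := foldr contraction x s.

Definition self_similar (p : 'I_m.+1 -> R)
    (mu : probability (measurableTypeR R) R) : Prop :=
  forall A : set (measurableTypeR R), measurable A ->
    (mu A = \sum_(j < m.+1) (p j)%:E * pushforward mu (contraction j) A)%E.

(* The topological support, i.e. the complement of the largest open null set. *)
Definition measure_support (mu : probability (measurableTypeR R) R) : set R :=
  [set x | forall U : set R, open U -> U x -> (0 < mu U)%E].

Definition finite_type : Prop :=
  exists F : set R, [/\ finite_set F, F `<=` [set x | 0 <= x] &
    forall (n : nat) (s t : n.-tuple 'I_m.+1), (1 <= n)%N ->
      let gap := rho ^- n * `|word_map s 0 - word_map t 0| in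
      (1 - rho)^-1 * (d ord_max - d ord0) < gap \/ F gap].

(* A closed interval [a, b] is encoded by the pair (a, b). *)
Definition points (D : R * R) : set R := `[D.1, D.2]%classic.

Definition endpoints (n : nat) : seq R :=
  sort <=%R (undup ([seq word_map s 0 | s : n.-tuple 'I_m.+1] ++
                    [seq word_map s 1 | s : n.-tuple 'I_m.+1])).

(* The net intervals of level n, listed from left to right. *)
Definition net_intervals (n : nat) : seq (R * R) :=
  if n is 0 then [:: (0, 1)] else zip (endpoints n) (behead (endpoints n)).

Definition children (n : nat) (E : R * R) : seq (R * R) :=
  [seq D <- net_intervals n.+1 | `[< points D `<=` points E >]].

(* The parent, in level n, of a net interval D of level n.+1. The default
   value of [head] is not reached when the support is [0, 1]. *)
Definition parent (n : nat) (D : R * R) : R * R :=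
  head (0, 1) [seq E <- net_intervals n | `[< points D `<=` points E >]].

Definition normalized_length (n : nat) (D : R * R) : R :=
  rho ^- n * (D.2 - D.1).

Definition neighbours (n : nat) (D : R * R) : seq R :=
  sort <=%R (undup
    [seq rho ^- n * (D.1 - word_map s 0) | s : n.-tuple 'I_m.+1 <- enum {: n.-tuple 'I_m.+1}
       & `[< points D `<=` word_map s @` `[0, 1]%classic >]]).

Definition char_vector : Type := (R * seq R * nat)%type.

(* The third component is a position counted from 1. *)
Definition characteristic (n : nat) (D : R * R) : char_vector :=
  if n is k.+1 then
    (normalized_length n D, neighbours n D,
     (index D [seq E <- children k (parent k D)
                | (normalized_length n E == normalized_length n D)
                  && (neighbours n E == neighbours n D)]).+1)
  else (1, [:: 0], 1%N).

Definition Omega : set char_vector :=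
  [set g | exists n, exists2 D, D \in net_intervals n & g = characteristic n D].

Definition is_parent (a b : char_vector) : Prop :=
  exists n E D, [/\ E \in net_intervals n, D \in children n E,
    a = characteristic n E & b = characteristic n.+1 D].

Definition admissible_path (g : seq char_vector) : Prop :=
  (forall a, a \in g -> Omega a) /\ sorted (fun a b => `[< is_parent a b >]) g.

Definition loop_class (O : set char_vector) : Prop :=
  [/\ O !=set0, O `<=` Omega &
    forall a b, O a -> O b -> exists g : seq char_vector,
      [/\ (2 <= size g)%N, admissible_path g, (forall c, c \in g -> O c),
          head a g = a & last a g = b]].

Definition is_essential_class (O : set char_vector) : Prop :=
  loop_class O /\ forall a b, O a -> is_parent a b -> O b.

(* The essential class. For a measure of finite type with support [0, 1]
   exactly one set satisfies [is_essential_class] (Feng). *)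
Definition essential_class : set char_vector := xget set0 is_essential_class.

Definition symbolic_representation (x : R) (g : nat -> char_vector) : Prop :=
  exists D : nat -> R * R,
    [/\ forall n, D n \in net_intervals n, forall n, points (D n) x,
        forall n, D n.+1 \in children n (D n) &
        forall n, g n = characteristic n (D n)].

Definition essential_point (x : R) : Prop :=
  exists2 g, symbolic_representation x g &
    exists N, forall n, (N <= n)%N -> essential_class (g n).

Definition nonessential_points : set R :=
  [set x | 0 <= x <= 1 /\ ~ essential_point x].

End IteratedFunctionSystem.

(* Main.v *)
(** Choose a net interval [D] of level [n] with the largest possible number of
    neighbours; finite type bounds this number. For every word [s], each net
    interval of level [size s + n] inside [S_s D] inherits a shift of all
    neighbours of [D], so by maximality it has no others. Hence no further
    endpoint falls inside [S_s D], which is a net interval with the neighbours of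
    [D]. The children of [D] and of [S_s D] then have the same characteristic
    vectors, including the third component, although [D] and [S_s D] may differ in
    theirs. So if [H] is a child of [D], all [S_s H] share one vector. Every
    interval contains some [S_s H], so every element of [Omega] reaches this vector;
    the essential class exists and contains it, and the points of every [S_s H] are
    essential. The complement in [0, 1] of the open set [U_s S_s (int H)] is closed,
    and it is null because every interval contains some [S_s H] of comparable
    length. *)

Require Import Defs.
From mathcomp Require Import all_boot all_order all_algebra.
From mathcomp Require Import all_classical all_reals all_analysis.
From mathcomp Require Import measurable_realfun lra.

Set Implicit Arguments.
Unset Strict Implicit.
Unset Printing Implicit Defensive.

Import Order.TTheory GRing.Theory Num.Theory.
Import numFieldNormedType.Exports.
Local Open Scope classical_set_scope.
Local Open Scope ring_scope.

(** * Consecutive elements of a finite set of reals *)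

Section ConsecutiveElements.
Context {R : realType}.
Implicit Types (a b x : R) (s : seq R) (D E : R * R).

Definition adjacent s D :=
  [/\ D.1 \in s, D.2 \in s, D.1 < D.2 & forall c, c \in s -> ~~ (D.1 < c < D.2)].

Lemma mem_zip_behead s D :
  sorted <%R s -> D \in zip s (behead s) <-> adjacent s D.
Proof.
elim: s => [|x [|y s] IHs] /=.
- by move=> _; split=> [//|[]].
- move=> _; split=> [//|[]]; rewrite !inE => /eqP -> /eqP ->.
  by rewrite ltxx.
move=> /andP[xy ys].
have xlt : {in y :: s, forall z, x < z}.
  move=> z; rewrite inE => /predU1P[->//|zs].
  by apply: lt_trans xy _; move: ys; rewrite lt_path_sortedE => /andP[/allP/(_ z zs)].
have yle : {in y :: s, forall z, y <= z}.
  move=> z; rewrite inE => /predU1P[->//|zs].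
  by move: ys; rewrite lt_path_sortedE => /andP[/allP/(_ z zs)/ltW].
rewrite inE; split.
- case/predU1P => [->|/(IHs ys)[D1 D2 lt_D Dadj]].
    split=> /=; rewrite ?inE ?eqxx ?orbT// => c.
    rewrite [c \in _]inE => /predU1P[->|/yle yc]; first by rewrite ltxx.
    by apply/negP => /andP[_]; rewrite ltNge yc.
  split=> //; rewrite 1?inE ?D1 ?D2 ?orbT// => c.
  rewrite [c \in _]inE => /predU1P[->|/Dadj//].
  by apply/negP => /andP[+ _]; rewrite ltNge (ltW (xlt _ D1)).
- case=> D1 D2 lt_D Dadj.
  have D2s : D.2 \in y :: s.
    move: D2; rewrite inE => /predU1P[D2x|//].
    move: D1; rewrite inE => /predU1P[D1x|/xlt].
      by move: lt_D; rewrite D1x D2x ltxx.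
    by rewrite -D2x ltNge (ltW lt_D).
  move: D1; rewrite inE => /predU1P[D1x|D1].
    have := Dadj y; rewrite !inE eqxx orbT => /(_ isT).
    rewrite D1x xy /= -leNgt => D2y; apply/orP; left.
    rewrite [D]surjective_pairing D1x; apply/eqP; congr (_, _).
    by apply/le_anti; rewrite D2y yle.
  apply/orP; right; apply/(IHs ys); split=> // c cs.
  by apply: Dadj; rewrite inE cs orbT.
Qed.

Lemma sorted_zip_behead s :
  sorted <%R s -> sorted (fun D E => D.1 < E.1) (zip s (behead s)).
Proof.
elim: s => [|x [|y s] IHs] //= /andP[xy ys].
by case: s ys IHs => [//|z s] ys /(_ ys) /= ->; rewrite xy.
Qed.

(** If two corresponding ends differed, one of them would lie strictly inside the other interval. *)
Lemma adjacent_uniq s D E x :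
  adjacent s D -> adjacent s E -> D.1 < x < D.2 -> E.1 <= x <= E.2 -> D = E.
Proof.
move=> [D1 D2 _ Dadj] [E1 E2 _ Eadj] /andP[D1x xD2] /andP[E1x xE2].
rewrite [D]surjective_pairing [E]surjective_pairing.
congr (_, _); apply/le_anti/andP; split; rewrite leNgt; apply/negP => lt_DE.
- by have := Dadj _ E1; have := Eadj _ D1; rewrite lt_DE (lt_le_trans D1x xE2).
- by have := Dadj _ E1; rewrite lt_DE (le_lt_trans E1x xD2).
- by have := Dadj _ E2; rewrite lt_DE (lt_le_trans D1x xE2).
- by have := Eadj _ D2; rewrite lt_DE (le_lt_trans E1x xD2).
Qed.

Lemma seq_has_max s a : a \in s -> exists2 c, c \in s & {in s, forall e, e <= c}.
Proof.
elim: s a => // y [|z u] IHu a _.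
  by exists y; rewrite ?inE// => e; rewrite inE => /eqP ->.
have [c cu cmax] := IHu z (mem_head _ _).
have [yc|cy] := leP y c.
  by exists c; rewrite 1?inE ?cu ?orbT// => e; rewrite inE => /predU1P[->//|/cmax].
exists y; rewrite ?mem_head// => e; rewrite inE => /predU1P[->//|/cmax ec].
exact: le_trans ec (ltW cy).
Qed.

Lemma seq_has_min s a : a \in s -> exists2 c, c \in s & {in s, forall e, c <= e}.
Proof.
move=> sa; have [|c /mapP[e es ->] emin] := @seq_has_max (map -%R s) (- a).
  exact: map_f.
by exists e => // z zs; rewrite -lerN2 emin// map_f.
Qed.

Lemma adjacent_between s a b x : a \in s -> b \in s -> a < b -> a <= x <= b ->
  exists D, [/\ adjacent s D, a <= D.1, D.2 <= b & D.1 <= x <= D.2].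
Proof.
move=> sa sb ab /andP[ax xb].
(* The condition [e < b] matters only for x = b, where the left end must stay below b. *)
have [|c] := @seq_has_max [seq e <- s | (e <= x) && (e < b)] a.
  by rewrite mem_filter ax ab.
rewrite mem_filter => /andP[/andP[cx cb] cs] cmax.
have [|e] := @seq_has_min [seq e <- s | c < e] b; first by rewrite mem_filter cb.
rewrite mem_filter => /andP[ce es] emin.
exists (c, e); split=> /=.
- split=> // z zs; apply/negP => /= /andP[cz].
  by rewrite ltNge emin// mem_filter cz.
- by apply: cmax; rewrite mem_filter ax ab.
- by apply: emin; rewrite mem_filter cb.
- rewrite cx leNgt; apply/negP => ex; move: ce; rewrite ltNge cmax//.
  by rewrite mem_filter es (ltW ex) (lt_le_trans ex xb).
Qed.

End ConsecutiveElements.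


(** * Porous closed sets are Lebesgue null *)

Section Porosity.
Context {R : realType}.
Local Notation mu := (@lebesgue_measure R).

(* If each interval loses a fixed proportion of its length, then iterating in the
   two remaining pieces shows that the rest has arbitrarily small measure. *)
Lemma porous_measure0 (C : set R) (e : R) : closed C -> 0 < e <= 1 ->
  C `<=` `[0, 1] ->
  (forall a b, 0 <= a -> b <= 1 -> a < b -> exists u v,
    [/\ a <= u, u <= v, v <= b, e * (b - a) <= v - u & C `&` `]u, v[ = set0]) ->
  mu C = 0%E.
Proof.
move=> Ccl /andP[e0 e1] C01 porous.
have mI a b : mu `[a, b] = (Num.max (b - a) 0)%:E.
  rewrite lebesgue_measure_itv /= lte_fin; case: ltP => ab.
    by rewrite max_l// subr_ge0 ltW.
  by rewrite max_r// subr_le0.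
have mC a b : measurable (C `&` `[a, b]) by apply: measurableI => //; apply: closed_measurable.
have mC_le a b : (mu (C `&` `[a, b]) <= mu `[a, b])%E.
  apply: le_measure; rewrite ?inE; [exact: mC|exact: measurable_itv|exact: subIsetr].
have CI k a b : 0 <= a -> b <= 1 -> a <= b ->
    (mu (C `&` `[a, b]) <= ((1 - e) ^+ k * (b - a))%:E)%E.
  elim: k a b => [|k IHk] a b a0 b1 ab.
    rewrite expr0 mul1r; apply: le_trans (mC_le _ _) _.
    by rewrite mI lee_fin max_l ?subr_ge0.
  move: ab; rewrite le_eqVlt => /predU1P[<-|ab].
    rewrite subrr mulr0; apply: le_trans (mC_le _ _) _.
    by rewrite mI subrr maxxx.
  have [u [v [au uv vb euv Cuv]]] := porous a b a0 b1 ab.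
  apply: (@le_trans _ _ (mu ((C `&` `[a, u]) `|` (C `&` `[v, b])))).
    apply: le_measure; rewrite ?inE; [exact: mC|apply: measurableU; exact: mC|].
    move=> x [Cx]; rewrite /= !in_itv /= => /andP[ax xb].
    have [xu|ux] := leP x u; first by left; rewrite ax.
    have [xv|vx] := ltP x v; last by right; rewrite xb.
    by have : set0 x by rewrite -Cuv /= in_itv /= ux.
  have := @measureU2 _ _ _ mu _ _ (mC a u) (mC v b) => /le_trans; apply.
  apply: (@le_trans _ _ (((1 - e) ^+ k * (u - a))%:E + ((1 - e) ^+ k * (b - v))%:E)%E).
    by apply: leeD; apply: IHk => //; lra.
  (* The two pieces have total length (b - a) - (v - u), which is at most (1 - e) (b - a). *)
  rewrite -EFinD lee_fin -mulrDr exprSr -mulrA ler_wpM2l//; last lra.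
  by rewrite exprn_ge0// subr_ge0.
apply/eqP; rewrite eq_le measure_ge0 andbT; apply/lee_addgt0Pr => r r0.
have /cvgrPdist_le/(_ r r0)[N _ /(_ N (leqnn N))] :
    (GRing.exp (1 - e) : R^nat) @ \oo --> (0 : R).
  by apply: cvg_expr; rewrite ger0_norm; lra.
rewrite /= sub0r normrN ger0_norm ?exprn_ge0 ?subr_ge0// => Nr.
rewrite add0e -(setIidl C01).
apply: le_trans (CI N 0 1 _ _ _) _ => //.
by rewrite subr0 mulr1 lee_fin.
Qed.

End Porosity.

(** * Words, endpoints and net intervals *)

Section NetIntervals.
Context {R : realType} {m : nat} {rho : R} {d : 'I_m.+1 -> R}.
Implicit Types (s t : seq 'I_m.+1) (D E : R * R) (n : nat).
Local Notation word := (word_map rho d).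

Lemma word_mapE s x : word s x = rho ^+ size s * x + word s 0.
Proof.
elim: s x => [|j s IHs] x /=; first by rewrite expr0 mul1r addr0.
by rewrite /Defs.contraction IHs mulrDr mulrA -exprS addrA.
Qed.

Lemma word_map_cat s t x : word (s ++ t) x = word s (word t x).
Proof. exact: foldr_cat. Qed.

(** Apart from [rho01], these are consequences of a support equal to [0, 1] and of increasing
    digits; the self-similar measure itself does not occur in this section. *)
Context (rho01 : 0 < rho < 1) (d_first : d ord0 = 0) (d_last : d ord_max = 1 - rho).
Context (d_itv : forall j, 0 <= d j <= 1 - rho).
Context (d_cover : forall x : R, 0 <= x <= 1 ->
  exists j (y : R), 0 <= y <= 1 /\ x = Defs.contraction rho d j y).

Lemma rhoX_gt0 n : 0 < rho ^+ n.
Proof. by rewrite exprn_gt0; case/andP: rho01. Qed.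

Lemma word_map_lt s x y : x < y -> word s x < word s y.
Proof. by move=> xy; rewrite (word_mapE s x) (word_mapE s y) ltrD2r ltr_pM2l ?rhoX_gt0. Qed.

Lemma word_map_ltE s : {mono word s : x y / x < y}.
Proof. by apply: leW_mono; apply: le_mono => x y; apply: word_map_lt. Qed.

Lemma word_map_leE s : {mono word s : x y / x <= y}.
Proof. by apply: le_mono => x y; apply: word_map_lt. Qed.

Lemma word_map_inj s : injective (word s).
Proof. exact: inc_inj (word_map_leE s). Qed.

Lemma word_map1 s : word s 1 = word s 0 + rho ^+ size s.
Proof. by rewrite word_mapE mulr1 addrC. Qed.

Lemma word_map_itv s x : 0 <= x <= 1 -> 0 <= word s x <= 1.
Proof.
move=> x01; elim: s => //= j s; rewrite /Defs.contraction; set y := word _ _.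
move=> /andP[y0 y1]; have /andP[r0 r1] := rho01; have /andP[dj0 dj1] := d_itv j.
by nra.
Qed.

Lemma word_map_cover n x : 0 <= x <= 1 ->
  exists s y, [/\ size s = n, 0 <= y <= 1 & x = word s y].
Proof.
elim: n x => [|n IHn] x x01; first by exists [::], x.
have [j [y [y01 ->]]] := d_cover x01.
by have [s [z [sn z01 ->]]] := IHn _ y01; exists (j :: s), z; split=> //=; rewrite sn.
Qed.

Lemma endpointsP n e : reflect
  (exists s, size s = n /\ (e = word s 0 \/ e = word s 1)) (e \in endpoints rho d n).
Proof.
rewrite /endpoints mem_sort mem_undup mem_cat; apply: (iffP orP).
  by case=> /mapP[/= s _ ->]; exists s; rewrite size_tuple; split; [|left| |right].
case=> s [sn es]; have sn' : size s == n by apply/eqP.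
case: es => ->; [left|right]; apply/mapP; exists (Tuple sn') => //;
by rewrite mem_enum.
Qed.

Lemma endpoints_sorted n : sorted <%R (endpoints rho d n).
Proof. by rewrite sort_lt_sorted undup_uniq. Qed.

Lemma endpoints_itv n e : e \in endpoints rho d n -> 0 <= e <= 1.
Proof.
by move=> /endpointsP[s [_ [->|->]]]; apply: word_map_itv; rewrite ?lexx ?ler01.
Qed.

Lemma word_map_nseq0 n : word (nseq n ord0) 0 = 0.
Proof. by elim: n => //= n ->; rewrite /Defs.contraction d_first mulr0 addr0. Qed.

Lemma word_map_nseq1 n : word (nseq n ord_max) 1 = 1.
Proof. by elim: n => //= n ->; rewrite /Defs.contraction d_last mulr1 addrC subrK. Qed.

Lemma endpoints0 n : 0 \in endpoints rho d n.
Proof.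
by apply/endpointsP; exists (nseq n ord0); rewrite size_nseq word_map_nseq0; split; [|left].
Qed.

Lemma endpoints1 n : 1 \in endpoints rho d n.
Proof.
by apply/endpointsP; exists (nseq n ord_max); rewrite size_nseq word_map_nseq1; split; [|right].
Qed.

Lemma endpoints_cat n k s e : size s = n -> e \in endpoints rho d k ->
  word s e \in endpoints rho d (n + k).
Proof.
move=> sn /endpointsP[t [tk et]]; apply/endpointsP; exists (s ++ t).
by rewrite size_cat sn tk !word_map_cat; split=> //; case: et => ->; [left|right].
Qed.

(** The first map fixes 0 and the last one fixes 1, so a word can be lengthened without moving its
    endpoint. *)
Lemma endpointsS n : {subset endpoints rho d n <= endpoints rho d n.+1}.
Proof.
move=> e /endpointsP[s [sn es]]; rewrite -addn1.
by case: es => ->; apply: endpoints_cat; rewrite ?endpoints0 ?endpoints1.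
Qed.

Lemma net_intervalsP n D :
  D \in net_intervals rho d n <-> adjacent (endpoints rho d n) D.
Proof.
suff -> : net_intervals rho d n = zip (endpoints rho d n) (behead (endpoints rho d n)).
  by apply: mem_zip_behead; apply: endpoints_sorted.
(* Level 0 is defined separately, but its only interval is also the pair formed by its endpoints 0
   and 1. *)
case: n => [|//]; suff -> : endpoints rho d 0 = [:: 0; 1]; first exact: erefl.
apply: lt_sorted_eq; first exact: endpoints_sorted.
  by rewrite /= ltr01.
move=> e; rewrite !inE; apply/endpointsP/orP => [[s [/size0nil -> /= [->|->]]]|].
- by left.
- by right.
- by case=> /eqP ->; exists [::]; split=> //=; [left|right].
Qed.

Lemma net_intervals_sorted n :
  sorted (fun D E => D.1 < E.1) (net_intervals rho d n).
Proof.
case: n => [//|n] /=; exact/sorted_zip_behead/endpoints_sorted.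
Qed.

Lemma subset_points D E : D.1 <= D.2 ->
  points D `<=` points E <-> E.1 <= D.1 /\ D.2 <= E.2.
Proof.
rewrite /points => D12; split=> [sDE|[ED1 DE2] x /=].
  have := sDE D.1; have := sDE D.2; rewrite /= !in_itv /= !lexx D12.
  by move=> /(_ isT)/andP[_ ->] /(_ isT)/andP[->].
by rewrite !in_itv /= => /andP[/(le_trans ED1) -> /le_trans ->].
Qed.

Lemma net_interval_lt n D : D \in net_intervals rho d n -> D.1 < D.2.
Proof. by move=> /net_intervalsP[]. Qed.

Lemma net_interval_itv n D : D \in net_intervals rho d n -> 0 <= D.1 /\ D.2 <= 1.
Proof. by move=> /net_intervalsP[/endpoints_itv/andP[-> _] /endpoints_itv/andP[_ ->]]. Qed.

Lemma mem_children n D E : D \in children rho d n E <->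
  D \in net_intervals rho d n.+1 /\ (E.1 <= D.1 /\ D.2 <= E.2).
Proof.
rewrite mem_filter; split=> [/andP[/asboolP sDE Dn]|[Dn DE]].
  by split=> //; apply/subset_points => //; apply/ltW/net_interval_lt/Dn.
rewrite Dn andbT; apply/asboolP/subset_points => //.
exact/ltW/net_interval_lt/Dn.
Qed.

Lemma exists_net_interval n a b x :
  a \in endpoints rho d n -> b \in endpoints rho d n -> a < b -> a <= x <= b ->
  exists D, [/\ D \in net_intervals rho d n, a <= D.1, D.2 <= b & D.1 <= x <= D.2].
Proof.
move=> an bn ab axb; have [D [Dadj aD Db xD]] := adjacent_between an bn ab axb.
by exists D; split=> //; apply/net_intervalsP.
Qed.

Lemma exists_child n D x : D \in net_intervals rho d n -> D.1 <= x <= D.2 ->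
  exists2 E, E \in children rho d n D & E.1 <= x <= E.2.
Proof.
move=> /net_intervalsP[D1 D2 lt_D _] xD.
have [E [En DE ED xE]] := exists_net_interval (endpointsS D1) (endpointsS D2) lt_D xD.
by exists E => //; apply/mem_children.
Qed.

Definition midpoint D := (D.1 + D.2) / 2.

Lemma midpoint_in D : D.1 < D.2 -> D.1 < midpoint D < D.2.
Proof. by move=> D12; rewrite /midpoint !midf_lt. Qed.

(** A level n interval around the midpoint of D works: its ends are also endpoints of level n + 1,
    so they cannot fall strictly inside D. *)
Lemma exists_parent n D : D \in net_intervals rho d n.+1 ->
  exists2 E, E \in net_intervals rho d n & D \in children rho d n E.
Proof.
move=> Dn; have D12 := net_interval_lt Dn; have [D0 D1] := net_interval_itv Dn.
have /andP[Dmid midD] := midpoint_in D12.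
have mid01 : 0 <= midpoint D <= 1 by lra.
have [E [En _ _ /andP[Emid midE]]] :=
  exists_net_interval (endpoints0 n) (endpoints1 n) ltr01 mid01.
exists E => //; apply/mem_children; split=> //.
have [E1 E2 _ _] := (net_intervalsP n E).1 En.
have [_ _ _ Dadj] := (net_intervalsP n.+1 D).1 Dn.
have := Dadj _ (endpointsS E1); have := Dadj _ (endpointsS E2).
rewrite (lt_le_trans Dmid midE) (le_lt_trans Emid midD) andbT /=.
by rewrite -!leNgt.
Qed.

Lemma net_interval_uniq n D E x :
  D \in net_intervals rho d n -> E \in net_intervals rho d n ->
  D.1 < x < D.2 -> E.1 <= x <= E.2 -> D = E.
Proof. by move=> /net_intervalsP + /net_intervalsP; apply: adjacent_uniq. Qed.

(** The filtered list contains E, so [head] does not return its default. Each member contains the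
    midpoint of D, which is interior to E, and hence is E. *)
Lemma parentE n D E : E \in net_intervals rho d n -> D \in children rho d n E ->
  parent rho d n D = E.
Proof.
move=> En DE; have /mem_children[Dn [ED1 DE2]] := DE.
have D12 := net_interval_lt Dn.
have : E \in [seq F <- net_intervals rho d n | `[< points D `<=` points F >]].
  by rewrite mem_filter En andbT; apply/asboolP/subset_points => //; apply/ltW.
rewrite /parent; case filterE: [seq F <- _ | _] => [//|F r] _ /=.
have : F \in F :: r by rewrite mem_head.
rewrite -filterE mem_filter => /andP[/asboolP/(subset_points _ (ltW D12))[FD1 DF2] Fn].
have /andP[Dmid midD] := midpoint_in D12.
apply/esym/(net_interval_uniq En Fn (x := midpoint D)).
  by rewrite (le_lt_trans ED1)//= (lt_le_trans midD).
by rewrite (le_trans FD1 (ltW Dmid)) (le_trans (ltW midD)).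
Qed.

(** * Covering words and neighbours *)

Definition covers s D := (word s 0 <= D.1) && (D.2 <= word s 1).

Lemma sub_word_map_itv s D : D.1 <= D.2 ->
  points D `<=` word s @` `[0, 1] <-> covers s D.
Proof.
move=> D12; have -> : word s @` `[0, 1] = points (word s 0, word s 1).
  apply/seteqP; split=> [_ [x + <-]|x]; rewrite /points /= !in_itv /=.
    by move=> /andP[x0 x1]; rewrite !word_map_leE x0 x1.
  move=> xI; exists (rho ^- size s * (x - word s 0)); last first.
    by rewrite word_mapE mulrA divff ?mul1r ?subrK// gt_eqF// rhoX_gt0.
  rewrite /= in_itv /=; rewrite word_map1 in xI.
  by rewrite ler_pdivrMl ?ler_pdivlMl ?rhoX_gt0// mulr0 mulr1; lra.
by rewrite subset_points//=; split=> [/andP|/andP].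
Qed.

Lemma neighboursP n D v : D.1 <= D.2 -> reflect
  (exists s, [/\ size s = n, covers s D & v = rho ^- n * (D.1 - word s 0)])
  (v \in neighbours rho d n D).
Proof.
move=> D12; rewrite /neighbours mem_sort mem_undup; apply: (iffP mapP).
  case=> s; rewrite mem_filter => /andP[/asboolP/(sub_word_map_itv s D12) sD _] ->.
  by exists s; rewrite size_tuple.
case=> s [sn sD ->]; have sn' : size s == n by apply/eqP.
exists (Tuple sn') => //; rewrite mem_filter mem_enum andbT.
by apply/asboolP/sub_word_map_itv.
Qed.

Lemma neighbours_uniq n D : uniq (neighbours rho d n D).
Proof. by rewrite sort_uniq undup_uniq. Qed.

Lemma eq_neighbours n k D E :
  neighbours rho d n D =i neighbours rho d k E -> neighbours rho d n D = neighbours rho d k E.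
Proof.
move=> eqDE; apply: lt_sorted_eq => //; by rewrite sort_lt_sorted undup_uniq.
Qed.

(** Both ends of the image of s are endpoints of level n, so neither is interior to D: an image that
    meets the interior of D contains D. *)
Lemma covers_of_mem n s D x : size s = n -> D \in net_intervals rho d n ->
  D.1 < x < D.2 -> word s 0 <= x <= word s 1 -> covers s D.
Proof.
move=> sn /net_intervalsP[_ _ _ Dadj] /andP[Dx xD] /andP[sx xs].
have s0 : word s 0 \in endpoints rho d n by apply/endpointsP; exists s; split; [|left].
have s1 : word s 1 \in endpoints rho d n by apply/endpointsP; exists s; split; [|right].
have := Dadj _ s0; have := Dadj _ s1.
by rewrite (lt_le_trans Dx xs) (le_lt_trans sx xD) andbT /= -!leNgt /covers => -> ->.
Qed.

Lemma exists_covers n D : D \in net_intervals rho d n -> exists2 s, size s = n & covers s D.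
Proof.
move=> Dn; have D12 := net_interval_lt Dn; have [D0 D1] := net_interval_itv Dn.
have Dmid := midpoint_in D12.
have [|s [y [sn /andP[y0 y1] midE]]] := @word_map_cover n (midpoint D); first by lra.
exists s => //; apply: (@covers_of_mem n s D (midpoint D)) => //.
by rewrite midE !word_map_leE y0.
Qed.

(** * Net intervals carried over by the map of a word *)

Definition image_pair s D := (word s D.1, word s D.2).

(** Passing from D to its image creates no new neighbours; that none is lost is automatic by
    [covers_cat]. Words may overlap exactly, so t is compared with s ++ u as a map, for which the
    value at 0 suffices ([eq_word_map]). *)
Definition copies s n D :=
  [/\ D \in net_intervals rho d n, image_pair s D \in net_intervals rho d (size s + n) &
    forall t, size t = (size s + n)%N -> covers t (image_pair s D) ->
      exists u, [/\ size u = n, covers u D & word t 0 = word s (word u 0)]].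

Lemma eq_word_map s t : size s = size t -> word s 0 = word t 0 -> word s =1 word t.
Proof. by move=> st st0 x; rewrite (word_mapE s) (word_mapE t) st st0. Qed.

Lemma eq_covers s t D : word s =1 word t -> covers s D = covers t D.
Proof. by move=> st; rewrite /covers !st. Qed.

Lemma covers_cat s u D : covers (s ++ u) (image_pair s D) = covers u D.
Proof. by rewrite /covers !word_map_cat !word_map_leE. Qed.

Lemma normalized_word_mapB s n x y :
  rho ^- (size s + n) * (word s x - word s y) = rho ^- n * (x - y).
Proof.
have rho0 : rho != 0 by rewrite gt_eqF//; case/andP: rho01.
rewrite (word_mapE s x) (word_mapE s y) opprD addrACA subrr addr0 -mulrBr.
by rewrite exprD invfM [_^-1 * _^-1]mulrC -mulrA mulKf ?expf_neq0.
Qed.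

Lemma copies_length s n D :
  normalized_length rho (size s + n) (image_pair s D) = normalized_length rho n D.
Proof. exact: normalized_word_mapB. Qed.

Lemma copies_neighbours s n D : copies s n D ->
  neighbours rho d (size s + n) (image_pair s D) = neighbours rho d n D.
Proof.
move=> [Dn sDn sDcov]; apply: eq_neighbours => v.
have D12 := ltW (net_interval_lt Dn); have sD12 := ltW (net_interval_lt sDn).
apply/(neighboursP _ _ sD12)/(neighboursP _ _ D12) => -[t [tn tD ->]].
  have [u [un uD ->]] := sDcov t tn tD.
  by exists u; split=> //; rewrite normalized_word_mapB.
exists (s ++ t); rewrite size_cat tn covers_cat; split=> //.
by rewrite word_map_cat normalized_word_mapB.
Qed.

Lemma word_map_rcons_itv t j x : 0 <= x <= 1 ->
  word t 0 <= word (rcons t j) x <= word t 1.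
Proof.
move=> /(word_map_itv [:: j])/andP[x0 x1].
by rewrite -cats1 word_map_cat !word_map_leE x0 x1.
Qed.

Lemma size_rconsP (T : Type) n (t : seq T) : size t = n.+1 ->
  exists u j, t = rcons u j /\ size u = n.
Proof.
case/lastP: t => // u j; rewrite size_rcons => -[un].
by exists u, j.
Qed.

(** Dropping the last letter of the word that produces e leaves a word t whose image still contains
    e. If e is interior to the image of D, then t covers that image and acts as s ++ u, so e is the
    image under s of an endpoint given by u and the dropped letter. *)
Lemma copies_endpoints s n D e : copies s n D ->
  e \in endpoints rho d (size s + n.+1) -> word s D.1 <= e <= word s D.2 ->
  exists2 e', e' \in endpoints rho d n.+1 & e = word s e'.
Proof.
move=> [Dn sDn sDcov] en /andP[].
have [D1 D2 _ _] := (net_intervalsP n D).1 Dn.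
rewrite le_eqVlt => /predU1P[<- _|De]; first by exists D.1 => //; apply: endpointsS.
rewrite le_eqVlt => /predU1P[->|eD]; first by exists D.2 => //; apply: endpointsS.
move: en; rewrite addnS => /endpointsP[_ [/size_rconsP[t [j [-> tn]]] et]].
have /(sDcov t tn)[u [un uD tu]] : covers t (image_pair s D).
  apply: (@covers_of_mem _ _ _ e tn sDn); first by rewrite De.
  by case: et => ->; apply: word_map_rcons_itv; rewrite ?lexx ?ler01.
have tsu : word t =1 word (s ++ u).
  by apply: eq_word_map; rewrite ?size_cat ?un// word_map_cat.
have tuj x : word (rcons t j) x = word s (word (rcons u j) x).
  by rewrite -!cats1 !word_map_cat tsu word_map_cat.
have ujn : size (rcons u j) = n.+1 by rewrite size_rcons un.
case: et => ->; rewrite tuj; eexists; try reflexivity; apply/endpointsP;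
  by exists (rcons u j); auto.
Qed.

(** The property passes to children because a covering word of the next level, without its last
    letter, covers the image of D and so factors through s. *)
Lemma copies_child s n D E : copies s n D -> E \in children rho d n D -> copies s n.+1 E.
Proof.
move=> sD /mem_children[En [DE1 DE2]].
have [E1 E2 lt_E Eadj] := (net_intervalsP n.+1 E).1 En.
have sEn : image_pair s E \in net_intervals rho d (size s + n.+1).
  apply/net_intervalsP; split=> /=; rewrite ?word_map_ltE ?endpoints_cat//.
  move=> c cn; apply/negP => /= /andP[Ec cE].
  have [|e en ce] := copies_endpoints sD cn.
    by rewrite (le_trans _ (ltW Ec)) ?(le_trans (ltW cE))// word_map_leE.
  by have := Eadj _ en; move: Ec cE; rewrite ce !word_map_ltE => -> ->.
split=> // t; rewrite addnS => tn tE.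
have [t' [j [tE' t'n]]] := size_rconsP tn.
have [Dn sDn sDcov] := sD.
have /(sDcov t' t'n)[u [un uD t'u]] : covers t' (image_pair s D).
  have /midpoint_in/andP[Emid midE] := net_interval_lt sEn.
  have [D1 D2 _ _] := (net_intervalsP n D).1 Dn.
  apply: (@covers_of_mem _ _ _ (midpoint (image_pair s E)) t'n sDn).
    rewrite (le_lt_trans _ Emid) ?(lt_le_trans midE)//= word_map_leE//.
  have /andP[tE1 tE2] := tE.
  have /andP[t'0 _] := @word_map_rcons_itv t' j 0 (introT andP (conj (lexx _) ler01)).
  have /andP[_ t'1] := @word_map_rcons_itv t' j 1 (introT andP (conj ler01 (lexx _))).
  rewrite -tE' in t'0 t'1.
  rewrite (le_trans t'0) ?(le_trans _ t'1)//; first exact: le_trans (ltW midE) tE2.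
  exact: le_trans tE1 (ltW Emid).
have tsu : word t =1 word (s ++ rcons u j).
  have t'su : word t' =1 word (s ++ u).
    by apply: eq_word_map; rewrite ?size_cat ?un// word_map_cat.
  by move=> x; rewrite tE' -!cats1 !word_map_cat t'su word_map_cat.
exists (rcons u j); rewrite size_rcons un; split=> //.
  by rewrite -(covers_cat s) -(eq_covers _ tsu).
by rewrite tsu word_map_cat.
Qed.

(** Equality as lists is needed for the position in the characteristic vector. Both lists increase
    with the left end, so comparing their members is enough. *)
Lemma copies_children s n D : copies s n D ->
  children rho d (size s + n) (image_pair s D) = map (image_pair s) (children rho d n D).
Proof.
move=> sD; have [Dn sDn _] := sD.
apply: (@irr_sorted_eq _ (fun E F => E.1 < F.1)).
- by move=> ? ? ?; apply: lt_trans.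
- by move=> ?; apply: ltxx.
- apply: sorted_filter; last exact: net_intervals_sorted.
  by move=> ? ? ?; apply: lt_trans.
- rewrite sorted_map; apply: (@sub_sorted _ (fun E F => E.1 < F.1)).
    by move=> E F; rewrite /= word_map_ltE.
  apply: sorted_filter; last exact: net_intervals_sorted.
  by move=> ? ? ?; apply: lt_trans.
move=> G; apply/idP/mapP => [/mem_children[Gn [DG1 DG2]]|[E ED ->]]; last first.
  have [_ + _] := copies_child sD ED; rewrite addnS => sEn.
  apply/mem_children; split=> //=; rewrite !word_map_leE.
  by have [] := (mem_children n E D).1 ED.
have [G1 G2 lt_G Gadj] := (net_intervalsP _ G).1 Gn.
rewrite -addnS in G1 G2 Gadj.
have [|e1 e1n Ge1] := copies_endpoints sD G1.
  by rewrite DG1 (le_trans (ltW lt_G)).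
have [|e2 e2n Ge2] := copies_endpoints sD G2.
  by rewrite DG2 (le_trans _ (ltW lt_G)).
exists (e1, e2); last by rewrite /image_pair /= -Ge1 -Ge2 -surjective_pairing.
apply/mem_children; split.
  apply/net_intervalsP; split=> //=; first by rewrite -(word_map_ltE s) -Ge1 -Ge2.
  move=> c cn; have := Gadj (word s c); rewrite endpoints_cat// Ge1 Ge2 !word_map_ltE.
  exact.
by move: DG1 DG2; rewrite /= Ge1 Ge2 !word_map_leE.
Qed.

Lemma copies_characteristic s n D E : copies s n D -> E \in children rho d n D ->
  characteristic rho d (size s + n.+1) (image_pair s E) = characteristic rho d n.+1 E.
Proof.
move=> sD ED; have [Dn sDn _] := sD; have sE := copies_child sD ED.
have sED : image_pair s E \in children rho d (size s + n) (image_pair s D).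
  by rewrite copies_children// map_f.
have nbE F : F \in children rho d n D ->
    neighbours rho d (size s + n).+1 (image_pair s F) = neighbours rho d n.+1 F.
  by move=> /(copies_child sD)/copies_neighbours; rewrite addnS.
have lenE F : normalized_length rho (size s + n).+1 (image_pair s F) =
    normalized_length rho n.+1 F.
  by rewrite -addnS copies_length.
rewrite addnS /characteristic (parentE sDn sED) (parentE Dn ED) lenE nbE//.
(* The siblings with equal length and neighbours correspond under the injective map of s, which
   preserves [index]. *)
congr (_, _, _.+1); rewrite copies_children// filter_map index_map; last first.
  by move=> [x y] [x' y'] [/(word_map_inj) -> /word_map_inj ->].
congr index; apply: eq_in_filter => F FD /=.
by rewrite lenE nbE.
Qed.

(** * Net intervals with the largest number of neighbours *)

(** If u covers D, then s ++ u covers G. This embeds the neighbours of D into those of G by a shift,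
    and by maximality the embedding is onto. *)
Lemma maximal_covers n D s G t : D \in net_intervals rho d n ->
  (forall k E, E \in net_intervals rho d k ->
     (size (neighbours rho d k E) <= size (neighbours rho d n D))%N) ->
  G \in net_intervals rho d (size s + n) -> word s D.1 <= G.1 -> G.2 <= word s D.2 ->
  size t = (size s + n)%N -> covers t G ->
  exists u, [/\ size u = n, covers u D & word t 0 = word s (word u 0)].
Proof.
move=> Dn Dmax Gn DG1 DG2 tn tG.
have D12 := ltW (net_interval_lt Dn); have G12 := ltW (net_interval_lt Gn).
(* Neighbours are measured from the left end of the interval, which moves from the image of D.1 to
   G.1. *)
pose shift v := v + rho ^- (size s + n) * (G.1 - word s D.1).
have shiftE u : shift (rho ^- n * (D.1 - word u 0)) =
    rho ^- (size s + n) * (G.1 - word (s ++ u) 0).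
  by rewrite /shift -(normalized_word_mapB s) -mulrDr word_map_cat addrC addrA subrK.
have shift_sub : {subset map shift (neighbours rho d n D) <= neighbours rho d (size s + n) G}.
  move=> _ /mapP[_ /(neighboursP _ _ D12)[u [un uD ->]] ->]; rewrite shiftE.
  apply/(neighboursP _ _ G12); exists (s ++ u); rewrite size_cat un; split=> //.
  move: uD; rewrite -(covers_cat s) => /andP[/le_trans u1 /(le_trans _) u2].
  by rewrite /covers u1// u2.
have [||_ shift_eq] := uniq_min_size _ shift_sub _.
  by rewrite map_inj_uniq ?neighbours_uniq//; apply: addIr.
  by rewrite size_map Dmax.
have : rho ^- (size s + n) * (G.1 - word t 0) \in neighbours rho d (size s + n) G.
  by apply/(neighboursP _ _ G12); exists t.
rewrite -shift_eq => /mapP[_ /(neighboursP _ _ D12)[u [un uD ->]]].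
rewrite shiftE => /mulfI; rewrite invr_eq0 gt_eqF ?rhoX_gt0// => /(_ isT)/addrI/oppr_inj.
by rewrite word_map_cat; exists u.
Qed.

(** It remains to exclude an endpoint e of a word t strictly inside the image of D. The net interval
    G next to e on the side of the image of t is covered by t, so t acts as s ++ u with u covering
    D; then e cannot be interior. *)
Lemma maximal_copies n D s : D \in net_intervals rho d n ->
  (forall k E, E \in net_intervals rho d k ->
     (size (neighbours rho d k E) <= size (neighbours rho d n D))%N) ->
  copies s n D.
Proof.
move=> Dn Dmax; have [D1 D2 lt_D _] := (net_intervalsP n D).1 Dn.
have sD1 := endpoints_cat (erefl (size s)) D1; have sD2 := endpoints_cat (erefl (size s)) D2.
suff sDn : image_pair s D \in net_intervals rho d (size s + n).
  by split=> // t tn tsD; apply: (maximal_covers Dn Dmax sDn _ _ tn tsD) => /=.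
apply/net_intervalsP; split=> //=; first by rewrite word_map_ltE.
move=> e en; apply/negP => /= /andP[De eD].
have [t [tn et]] := endpointsP _ _ en.
have t0 : word t 0 \in endpoints rho d (size s + n) by apply/endpointsP; exists t; auto.
have t1 : word t 1 \in endpoints rho d (size s + n) by apply/endpointsP; exists t; auto.
have t01 : word t 0 < word t 1 by rewrite word_map_ltE ltr01.
case: et => eE.
- have [|G [Gn eG1 Gs /andP[G1e _]]] := exists_net_interval en sD2 eD (x := e).
    by rewrite lexx ltW.
  have Ge : G.1 = e by apply/le_anti; rewrite eG1 G1e.
  have tG : covers t G.
    have [_ _ _ Gadj] := (net_intervalsP _ G).1 Gn; have := Gadj _ t1.
    by rewrite /covers Ge eE lexx t01 /= -leNgt.
  have [|u [_ /andP[uD _] tu]] := maximal_covers Dn Dmax Gn _ Gs tn tG.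
    by rewrite (le_trans (ltW De)).
  by move: De; rewrite eE tu word_map_ltE ltNge uD.
- have [|G [Gn sG G2e /andP[_ eG2]]] := exists_net_interval sD1 en De (x := e).
    by rewrite lexx ltW.
  have Ge : G.2 = e by apply/le_anti; rewrite eG2 G2e.
  have tG : covers t G.
    have [_ _ _ Gadj] := (net_intervalsP _ G).1 Gn; have := Gadj _ t0.
    by rewrite /covers Ge eE lexx t01 andbT /= -leNgt andbT.
  have [|u [un /andP[_ uD] tu]] := maximal_covers Dn Dmax Gn sG _ tn tG.
    by rewrite (le_trans _ (ltW eD)).
  have tsu : word t =1 word (s ++ u).
    by apply: eq_word_map; rewrite ?size_cat ?un// word_map_cat.
  by move: eD; rewrite eE tsu word_map_cat word_map_ltE ltNge uD.
Qed.

(** Subtracting the least neighbour turns every neighbour into a normalized gap between two words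
    that cover D. Both images contain D, so the gap is at most 1, and finite type puts it into F. *)
Lemma neighbours_bounded : finite_type rho d ->
  exists B, forall n D, D \in net_intervals rho d n -> (size (neighbours rho d n D) <= B)%N.
Proof.
case=> _ [/finite_seqP[F ->] _ FT].
(* The extra 0 accounts for level 0, since finite type speaks of levels from 1 on. *)
exists (size (0 :: F)) => n D Dn; have D12 := net_interval_lt Dn.
have [t0 t0n t0D] := exists_covers Dn.
have [|v0 v0D v0min] := @seq_has_min _ (neighbours rho d n D) (rho ^- n * (D.1 - word t0 0)).
  by apply/(neighboursP _ _ (ltW D12)); exists t0.
rewrite -(size_map (fun v => v - v0)); apply: uniq_leq_size.
  by rewrite map_inj_uniq ?neighbours_uniq//; apply: addIr.
move=> _ /mapP[v vD ->].
have : 0 <= v - v0 by rewrite subr_ge0 v0min.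
move: vD v0D => /(neighboursP _ _ (ltW D12))[t [tn tD ->]].
move=> /(neighboursP _ _ (ltW D12))[u [un uD ->]].
rewrite -mulrBr opprB addrC addrA subrK => ge0.
have [n0|n0] := posnP n.
  by move: tn un; rewrite n0 => /size0nil -> /size0nil ->; rewrite subrr mulr0 mem_head.
have tn' : size t == n by apply/eqP.
have un' : size u == n by apply/eqP.
have := FT n (Tuple un') (Tuple tn') n0 => /=.
have dist_ge0 : 0 <= word u 0 - word t 0.
  by move: ge0; rewrite pmulr_rge0 ?invr_gt0 ?rhoX_gt0.
(* The threshold of finite type equals 1 here. *)
rewrite ger0_norm// d_first d_last subr0 mulVf ?subr_eq0; last first.
  by rewrite gt_eqF//; case/andP: rho01.
case=> [|uF]; last by rewrite inE uF orbT.
rewrite ltNge => /negP[]; rewrite ler_pdivrMl ?rhoX_gt0// mulr1 lerBlDl -tn -word_map1.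
by have /andP[u0 _] := uD; have /andP[_ t1] := tD; rewrite (le_trans u0)// (le_trans (ltW D12)).
Qed.

Lemma exists_maximal : finite_type rho d ->
  exists n D, D \in net_intervals rho d n /\
    forall k E, E \in net_intervals rho d k ->
     (size (neighbours rho d k E) <= size (neighbours rho d n D))%N.
Proof.
move=> /neighbours_bounded[B Bmax].
pose P k := `[< exists n D, D \in net_intervals rho d n /\ size (neighbours rho d n D) = k >].
have exP : exists k, P k.
  by exists (size (neighbours rho d 0 (0, 1))); apply/asboolP; exists 0%N, (0, 1); rewrite mem_head.
have leP k : P k -> (k <= B)%N by move=> /asboolP[n [D [Dn <-]]]; apply: Bmax.
case: (ex_maxnP exP leP) => k /asboolP[n [D [Dn <-]]] max; exists n, D; split=> // j E Ej.
by apply: max; apply/asboolP; exists j, E.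
Qed.

(** H is a child of a maximal D: the position of the image of H is counted among the children of the
    image of D, whereas that of the image of D itself depends on what lies around it. *)
Lemma exists_universal_vector : finite_type rho d ->
  exists n H b, [/\ 0 <= H.1, H.1 < H.2, H.2 <= 1 & forall s,
    image_pair s H \in net_intervals rho d (size s + n.+1) /\
    characteristic rho d (size s + n.+1) (image_pair s H) = b].
Proof.
move=> /exists_maximal[n [D [Dn Dmax]]].
have lt_D := net_interval_lt Dn.
have [|H HD _] := exists_child (x := D.1) Dn; first by rewrite lexx ltW.
have /mem_children[Hn _] := HD; have [H0 H1] := net_interval_itv Hn.
exists n, H, (characteristic rho d n.+1 H); split=> //; first exact: net_interval_lt Hn.
move=> s; have sD := maximal_copies s Dn Dmax.
by rewrite (copies_characteristic sD HD); have [] := copies_child sD HD.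
Qed.

(** Take the least n with rho^n at most (b - a) / 2 and a word of length n whose image contains the
    midpoint. Minimality gives the lower bound on the length. *)
Lemma interval_contains_word a b : 0 <= a -> b <= 1 -> a < b ->
  exists2 s, a <= word s 0 /\ word s 1 <= b & rho * ((b - a) / 2) <= rho ^+ size s.
Proof.
move=> a0 b1 ab; have /andP[r0 r1] := rho01.
have exn : exists n, rho ^+ n <= (b - a) / 2.
  have /cvgrPdist_le/(_ ((b - a) / 2)) : (GRing.exp rho : R^nat) @ \oo --> (0 : R).
    by apply: cvg_expr; rewrite ger0_norm// ltW.
  have ab0 : 0 < (b - a) / 2 by lra.
  move=> /(_ ab0)[N _ /(_ N (leqnn N))]; rewrite /= sub0r normrN ger0_norm; last exact/ltW/rhoX_gt0.
  by exists N.
(* The exponent 0 is impossible, as (b - a) / 2 is at most 1/2. *)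
case: (ex_minnP exn) => -[|n] rn nmin; first by move: rn; rewrite expr0; lra.
have [|s [x [sn /andP[x0 x1] midE]]] := @word_map_cover n.+1 ((a + b) / 2); first by lra.
have s0 : word s 0 <= (a + b) / 2 by rewrite midE word_map_leE.
have s1 : (a + b) / 2 <= word s 1 by rewrite midE word_map_leE.
rewrite word_map1 sn in s1.
exists s; rewrite ?word_map1 sn; first by split; lra.
rewrite exprS ler_pM2l// leNgt; apply/negP => /ltW/nmin.
by rewrite ltnn.
Qed.

(** * Reachability and the essential class *)

Notation parent_rel := (fun a b : char_vector => `[< is_parent rho d a b >]).

(** At least one step is required, to match the length of at least 2 in [loop_class]. *)
Definition reaches (a b : char_vector) :=
  exists p, [/\ p != [::], path parent_rel a p & last a p = b].

Lemma reaches_trans a b c : reaches a b -> reaches b c -> reaches a c.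
Proof.
move=> [p [p0 ap pb]] [q [_ bq qc]]; exists (p ++ q).
by rewrite cat_path ap pb bq last_cat pb; split=> //; case: p p0 {ap pb}.
Qed.

Lemma reaches_parent a b : is_parent rho d a b -> reaches a b.
Proof. by move=> ab; exists [:: b]; split=> //=; rewrite andbT; apply/asboolP. Qed.

Lemma is_parent_Omega a b : is_parent rho d a b -> Omega rho d a /\ Omega rho d b.
Proof.
move=> [n [E [D [En DE -> ->]]]]; split; first by exists n, E.
by exists n.+1, D => //; have /mem_children[] := DE.
Qed.

Lemma is_parent_child n D E : D \in net_intervals rho d n -> E \in children rho d n D ->
  is_parent rho d (characteristic rho d n D) (characteristic rho d n.+1 E).
Proof. by move=> Dn ED; exists n, D, E. Qed.

Lemma endpoints_leq n k : (n <= k)%N -> {subset endpoints rho d n <= endpoints rho d k}.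
Proof.
move=> nk; rewrite -(subnK nk); elim: (k - n)%N => // j IHj e /IHj.
exact: endpointsS.
Qed.

(** Induction through the parent P of E: the ends of D are endpoints of the level of P, so they are
    not interior to P and P stays inside D. *)
Lemma reaches_sub n k D E : D \in net_intervals rho d n ->
  E \in net_intervals rho d (n + k.+1) -> D.1 <= E.1 -> E.2 <= D.2 ->
  reaches (characteristic rho d n D) (characteristic rho d (n + k.+1) E).
Proof.
move=> Dn; elim: k E => [|k IHk] E.
  rewrite addn1 => En DE1 DE2; apply/reaches_parent/is_parent_child => //.
  exact/mem_children.
rewrite addnS => En DE1 DE2.
have [P Pn EP] := exists_parent En; have /mem_children[_ [PE1 PE2]] := EP.
have [_ _ _ Padj] := (net_intervalsP _ P).1 Pn.
have [D1 D2 _ _] := (net_intervalsP _ D).1 Dn.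
have le_nk : (n <= n + k.+1)%N by apply: leq_addr.
have lt_E := net_interval_lt En.
have := Padj _ (endpoints_leq le_nk D1); have := Padj _ (endpoints_leq le_nk D2).
rewrite (le_lt_trans PE1 (lt_le_trans lt_E DE2)) (le_lt_trans DE1 (lt_le_trans lt_E PE2)).
rewrite andbT /= -!leNgt => PD2 DP1.
apply: reaches_trans (IHk P Pn DP1 PD2) _.
exact/reaches_parent/is_parent_child.
Qed.

Lemma path_closed (O : set char_vector) a p :
  (forall b c, O b -> is_parent rho d b c -> O c) -> O a -> path parent_rel a p ->
  forall c, c \in a :: p -> O c.
Proof.
move=> Oclosed; elim: p a => [|b p IHp] a Oa /=.
  by move=> _ c; rewrite inE => /eqP ->.
move=> /andP[/asboolP/(Oclosed _ _ Oa) Ob /(IHp b Ob) bp] c.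
by rewrite inE => /predU1P[->|/bp].
Qed.

Lemma reaches_closed (O : set char_vector) a b :
  (forall b c, O b -> is_parent rho d b c -> O c) -> O a -> reaches a b -> O b.
Proof.
move=> Oclosed Oa [p [_ ap <-]]; apply: path_closed Oclosed Oa ap _ _.
exact: mem_last.
Qed.

Lemma reaches_Omega a b : Omega rho d a -> reaches a b -> Omega rho d b.
Proof. by apply: reaches_closed => ? ? _ /is_parent_Omega[]. Qed.

(** Two vectors reachable from b are joined by a path through b, and the path stays in the class
    because the class is closed under children. *)
Lemma is_essential_reachable b : Omega rho d b -> (forall a, Omega rho d a -> reaches a b) ->
  is_essential_class rho d [set c | reaches b c].
Proof.
move=> Ob to_b.
have closed_b : forall a c, reaches b a -> is_parent rho d a c -> reaches b c.
  by move=> a c ba /reaches_parent; apply: reaches_trans.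
split; last exact: closed_b.
split=> [|c|a c /= ba bc]; first by exists b; apply: to_b.
  exact: reaches_Omega.
have [p [p0 ap pc]] := reaches_trans (to_b _ (reaches_Omega Ob ba)) bc.
have bp := path_closed (O := reaches b) closed_b ba ap.
exists (a :: p); split=> //; first by case: p p0 {ap pc bp}.
by split=> // e /bp; apply: reaches_Omega.
Qed.

(** Existence of an essential class ensures that [xget] does not return [set0]. A member of the
    chosen class reaches b, and closedness under children brings b into the class. *)
Lemma essential_class_reachable b : Omega rho d b -> (forall a, Omega rho d a -> reaches a b) ->
  (forall a c, essential_class rho d a -> is_parent rho d a c -> essential_class rho d c) /\
  essential_class rho d b.
Proof.
move=> Ob to_b.
have [[[a Oa] sub_Omega _] Oclosed] : is_essential_class rho d (essential_class rho d).
  by apply: xgetPex; exists [set c | reaches b c]; apply: is_essential_reachable.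
split=> //; apply: (reaches_closed Oclosed Oa).
exact/to_b/sub_Omega.
Qed.

Lemma reaches_universal n H b g : 0 <= H.1 -> H.2 <= 1 -> (forall s,
    image_pair s H \in net_intervals rho d (size s + n.+1) /\
    characteristic rho d (size s + n.+1) (image_pair s H) = b) ->
  Omega rho d g -> reaches g b.
Proof.
move=> H0 H1 Hs [k [D Dk ->]].
have [D0 D1] := net_interval_itv Dk.
have [s [Ds sD] _] := interval_contains_word D0 D1 (net_interval_lt Dk).
(* The k extra letters raise the level of the image of H above the level k of D, while the image of
   t stays inside that of s. *)
pose t := s ++ nseq k ord0.
have t0 : word s 0 <= word t 0 by rewrite word_map_cat word_map_nseq0.
have t1 : word t 1 <= word s 1.
  rewrite word_map_cat word_map_leE.
  by have /andP[] := @word_map_itv (nseq k ord0) 1 (introT andP (conj ler01 (lexx _))).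
have [] := Hs t; have -> : (size t + n.+1 = k + (size s + n).+1)%N.
  by rewrite size_cat size_nseq !addnS [(size s + k)%N]addnC -addnA.
move=> tHn <-; apply: reaches_sub Dk tHn _ _ => /=.
  by rewrite (le_trans Ds) ?(le_trans t0)// word_map_leE.
by rewrite (le_trans _ sD) ?(le_trans _ t1)// word_map_leE.
Qed.

(** * Symbolic representations through a given net interval *)

Lemma exists_chain_above n D x : D \in net_intervals rho d n -> D.1 <= x <= D.2 ->
  exists f, [/\ f n = D, forall k, (n <= k)%N -> f k \in net_intervals rho d k,
    forall k, (n <= k)%N -> (f k).1 <= x <= (f k).2 &
    forall k, (n <= k)%N -> f k.+1 \in children rho d k (f k)].
Proof.
move=> Dn Dx.
(* Stated for all pairs, so that [choice] gives a total function; E is a dummy value when the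
   premises fail. *)
have next (k : nat) (E : R * R) : exists F, E \in net_intervals rho d k -> E.1 <= x <= E.2 ->
    F \in children rho d k E /\ F.1 <= x <= F.2.
  have [[Ek Ex]|nE] := pselect (E \in net_intervals rho d k /\ E.1 <= x <= E.2).
    by have [F FE Fx] := exists_child Ek Ex; exists F.
  by exists E => Ek Ex; case: nE.
have [step stepP] := choice (fun p : nat * (R * R) => next p.1 p.2).
(* For k < n the value D is a placeholder. *)
pose fix f k := if k is j.+1 then if (n <= j)%N then step (j, f j) else D else D.
have fn : f n = D.
  suff f_le k : (k <= n)%N -> f k = D by exact: f_le.
  by case: k => //= k; rewrite ltnNge => /negbTE ->.
have fP k : (n <= k)%N -> f k \in net_intervals rho d k /\ (f k).1 <= x <= (f k).2.
  move=> /subnK <-; elim: (k - n)%N => [|j [IHj1 IHj2]]; first by rewrite fn.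
  rewrite addSn /= leq_addl; have [] := stepP (_, _) IHj1 IHj2.
  by move=> /mem_children[].
exists f; split=> // k /[dup] nk /fP[fk1 fk2]//=.
by rewrite nk; have [] := stepP (_, _) fk1 fk2.
Qed.

Lemma exists_chain n D x : D \in net_intervals rho d n -> D.1 <= x <= D.2 ->
  exists f, [/\ f n = D, forall k, f k \in net_intervals rho d k,
    forall k, (f k).1 <= x <= (f k).2 & forall k, f k.+1 \in children rho d k (f k)].
Proof.
move=> /exists_chain_above /[apply] -[f [<- {D} fn fx fc]].
(* The levels before n are filled by induction on n, so the claim is made for an arbitrary chain f
   from level n on. *)
suff [g [gf gn gx gc]] : exists g, [/\ forall k, (n <= k)%N -> g k = f k,
    forall k, g k \in net_intervals rho d k, forall k, (g k).1 <= x <= (g k).2 &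
    forall k, g k.+1 \in children rho d k (g k)].
  by exists g; split=> //; rewrite gf.
elim: n f fn fx fc => [|n IHn] f fn fx fc.
  by exists f; split=> // k; [apply: fn|apply: fx|apply: fc].
have [E En fE] := exists_parent (fn _ (leqnn n.+1)).
have /mem_children[_ [Ef1 Ef2]] := fE.
have /andP[fx1 fx2] := fx _ (leqnn n.+1).
(* The parent of [f n.+1] extends the chain by one level, and the induction hypothesis supplies the
   remaining ones. *)
pose g k := if k == n then E else f k.
have gf k : (n < k)%N -> g k = f k by rewrite /g; case: ltngtP.
have gn : g n = E by rewrite /g eqxx.
have [k|k|k|h [hg hn hx hc]] := IHn g.
- by rewrite leq_eqVlt => /predU1P[<-|nk]; rewrite ?gn// gf// fn.
- rewrite leq_eqVlt => /predU1P[<-|nk]; rewrite ?gn ?gf ?fx//.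
  by rewrite (le_trans Ef1 fx1) (le_trans fx2).
- rewrite leq_eqVlt => /predU1P[<-|nk]; first by rewrite gn gf.
  by rewrite !gf ?fc// ltnW.
by exists h; split=> // k nk; rewrite hg ?gf// ltnW.
Qed.

Lemma essential_point_of_mem n D x :
  (forall a b, essential_class rho d a -> is_parent rho d a b -> essential_class rho d b) ->
  D \in net_intervals rho d n -> essential_class rho d (characteristic rho d n D) ->
  D.1 <= x <= D.2 -> essential_point rho d x.
Proof.
move=> ess_closed Dn essD /(exists_chain Dn)[f [fD fn fx fc]].
exists (fun k => characteristic rho d k (f k)).
  by exists f; split=> // k; rewrite /points /= in_itv /=.
exists n => k /subnK <-; elim: (k - n)%N => [|j IHj]; first by rewrite fD.
rewrite addSn; apply: (ess_closed _ _ IHj).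
exact: is_parent_child (fn _) (fc _).
Qed.

Lemma essential_point_in_images : finite_type rho d -> exists H,
  [/\ 0 <= H.1, H.1 < H.2, H.2 <= 1 &
    forall s x, word s H.1 <= x <= word s H.2 -> essential_point rho d x].
Proof.
move=> /exists_universal_vector[n [H [b [H0 H12 H1 Hs]]]].
exists H; split=> // s x sx; have [sHn sHb] := Hs s.
have [|ess_closed essb] := @essential_class_reachable b _ (fun g => reaches_universal H0 H1 Hs).
  by rewrite -sHb; exists (size s + n.+1)%N, (image_pair s H).
by apply: (essential_point_of_mem ess_closed sHn _ sx); rewrite sHb.
Qed.

Lemma nonessential_points_null : finite_type rho d -> exists C : set R,
  [/\ closed C, lebesgue_measure C = 0%E & nonessential_points rho d `<=` C].
Proof.
move=> /essential_point_in_images[H [H0 H12 H1 Hess]].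
pose U := \bigcup_(s in [set: seq 'I_m.+1]) `]word s H.1, word s H.2[%classic.
have Ccl : closed (`[0, 1] `&` ~` U).
  by apply: closedI; [exact: itv_closed|apply/open_closedC/bigcup_open => s _; exact: itv_open].
exists (`[0, 1] `&` ~` U); split=> //; last first.
  move=> x [x01 xness]; split; first by rewrite /= in_itv.
  move=> [s _ /=]; rewrite in_itv /= => /andP[/ltW sx /ltW xs]; apply: xness.
  by apply: (Hess s); rewrite sx.
have /andP[r0 r1] := rho01.
(* An interval of length b - a contains the image of [0, 1] under some word, of length at least rho
   (b - a) / 2; the image of H is the fraction H.2 - H.1 of it. *)
apply: (@porous_measure0 R _ (rho / 2 * (H.2 - H.1))) => //.
  by apply/andP; split; nra.
move=> a b a0 b1 ab; have [s [as0 s1b] lt_s] := interval_contains_word a0 b1 ab.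
have s0H1 : word s 0 <= word s H.1 by rewrite word_map_leE.
have sH21 : word s H.2 <= word s 1 by rewrite word_map_leE.
exists (word s H.1), (word s H.2); split.
- exact: le_trans s0H1.
- by rewrite word_map_leE ltW.
- exact: le_trans s1b.
- rewrite (word_mapE s H.2) (word_mapE s H.1) opprD addrACA subrr addr0 -mulrBr.
  have -> : rho / 2 * (H.2 - H.1) * (b - a) = rho * ((b - a) / 2) * (H.2 - H.1) by lra.
  by rewrite ler_wpM2r// subr_ge0 ltW.
- by apply/seteqP; split=> // x [[_ nU] xs]; apply: nU; exists s.
Qed.

End NetIntervals.

(** * Self-similarity of the support *)

Section Support.
Context {R : realType} {m : nat} (rho : R) (d p : 'I_m.+1 -> R)
  (mu : probability (measurableTypeR R) R).
Context (rho_gt0 : 0 < rho) (p_gt0 : forall j, 0 < p j) (mu_self : self_similar rho d p mu).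
Local Notation S := (Defs.contraction rho d).

Lemma contraction_preimage_open j (U : set R) : open U -> open (S j @^-1` U).
Proof.
apply: open_comp => x _; apply: continuousD; last exact: cst_continuous.
exact: mulrl_continuous.
Qed.

Lemma support_contraction j x : measure_support mu x -> measure_support mu (S j x).
Proof.
move=> mux U Uo USx; have Um : measurable U by apply: open_measurable.
rewrite (mu_self Um) (bigD1 j)//=.
have Sx : (0 < (p j)%:E * pushforward mu (S j) U)%E.
  apply: mule_gt0; first by rewrite lte_fin.
  by apply: mux => //; apply: contraction_preimage_open.
apply: lt_le_trans Sx _; apply: leeDl; apply: sume_ge0 => i _.
apply: mule_ge0; [by rewrite lee_fin ltW|exact: (measure_ge0 mu (S i @^-1` U))].
Qed.

(** Otherwise each preimage of x has an open null neighbourhood. Intersecting their images under the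
    finitely many maps gives a neighbourhood of x all of whose preimages are null, so it is null
    itself. *)
Lemma support_preimage x : measure_support mu x ->
  exists j y, measure_support mu y /\ x = S j y.
Proof.
move=> mux; apply: contrapT => /forallNP noj.
pose T j (z : R) : R := (z - d j) / rho.
have ST j z : S j (T j z) = z by rewrite /S /T mulrC divfK ?gt_eqF// subrK.
have TS j z : T j (S j z) = z by rewrite /S /T addrK mulrAC divff ?mul1r// gt_eqF.
have /choice[U UP] : forall j, exists U : set R,
    [/\ open U, U (T j x) & mu U = 0%E].
  move=> j; have /forallNP/(_ (T j x))/not_andP[] := noj j; last by rewrite ST.
  move=> /existsNP[U /not_implyP[Uo /not_implyP[UT U0]]]; exists U; split=> //.
  by apply/eqP; rewrite eq_le measure_ge0 andbT leNgt; apply/negP.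
have : nbhs x [set z | forall j, U j (T j z)].
  apply: (@filter_forall _ _ (fun j z => U j (T j z)) (nbhs x)) => j; have [Uo UT _] := UP j.
  have : {for x, continuous (T j)}.
    by apply: continuousM; [apply: continuousB; [exact: cvg_id|]|]; apply: cst_continuous.
  by apply; apply: open_nbhs_nbhs.
rewrite nbhsE => -[W [Wo Wx] WU].
have Wm : measurable W by apply: open_measurable.
have := mux _ Wo Wx; rewrite (mu_self Wm) big1 ?ltxx// => j _.
suff SW0 : mu (S j @^-1` W) = 0%E by rewrite [pushforward _ _ _]SW0 mule0.
have [Uo _ U0] := UP j.
apply/eqP; rewrite eq_le measure_ge0 andbT -U0; apply: le_measure; rewrite ?inE.
- by apply: open_measurable; apply: contraction_preimage_open.
- exact: open_measurable.
- by move=> z /WU /(_ j); rewrite TS.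
Qed.

End Support.

Theorem proposition4p5 (R : realType) (m : nat) (rho : R)
    (d p : 'I_m.+1 -> R) (mu : probability (measurableTypeR R) R) :
  (1 <= m)%N ->
  0 < rho < 1 ->
  (forall i j : 'I_m.+1, (i < j)%N -> d i < d j) ->
  (forall j, 0 < p j) ->
  \sum_(j < m.+1) p j = 1 ->
  self_similar rho d p mu ->
  finite_type rho d ->
  p ord0 = p ord_max ->
  (forall j, p ord0 <= p j) ->
  measure_support mu = `[0, 1]%classic ->
  exists C : set R,
    [/\ closed C, lebesgue_measure C = 0%E & nonessential_points rho d `<=` C].
Proof.
move=> _ rho01 d_lt p_gt0 _ mu_self FT _ _ supp.
have /andP[r0 r1] := rho01.
have suppE x : measure_support mu x <-> 0 <= x <= 1 by rewrite supp /= in_itv.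
have S01 j x : 0 <= x <= 1 -> 0 <= rho * x + d j <= 1.
  move=> /suppE x01; apply/suppE; exact: (@support_contraction _ _ rho d p mu).
have d_cover x : 0 <= x <= 1 -> exists j (y : R), 0 <= y <= 1 /\ x = Defs.contraction rho d j y.
  move=> /suppE/(support_preimage r0 mu_self)[j [y [/suppE y01 xE]]].
  by exists j, y.
have d_itv j : 0 <= d j <= 1 - rho.
  have := S01 j 0; have := S01 j 1; rewrite !lexx !ler01 mulr0 mulr1 => /(_ isT) + /(_ isT).
  by lra.
have d_le (i j : 'I_m.+1) : (i <= j)%N -> d i <= d j.
  by rewrite leq_eqVlt => /predU1P[/val_inj ->//|/d_lt/ltW].
(* In 0 = rho y + d_j both terms are non-negative, so d_j = 0, and d_0 lies between 0 and d_j. *)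
have d_first : d ord0 = 0.
  have [|j [y [y01 /esym]]] := d_cover 0; first by rewrite lexx ler01.
  have := d_le ord0 j (leq0n _); have := d_itv ord0; rewrite /Defs.contraction; nra.
(* In 1 = rho y + d_j the terms are at most rho and 1 - rho, so both bounds are attained. *)
have d_last : d ord_max = 1 - rho.
  have [|j [y [y01 /esym]]] := d_cover 1; first by rewrite lexx ler01.
  have := d_le j ord_max (leq_ord j); have := d_itv ord_max; rewrite /Defs.contraction; nra.
exact: nonessential_points_null d_itv d_cover FT.
Qed.
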